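(* Let $n\ge 2$ and $k\in\{1,\dots,n-1\}$ be integers. Let $X$ be a real symmetric positive definite $n\times n$ matrix and let $Y_i=v_iv_i^T$ ($i=1,\dots,m$, $v_i\in\mathbb{R}^n$) be such that $X+\sum_{i=1}^m Y_i=M^*$ with $\lambda_{\max}(M^* )\le 1$. Suppose each $Y_i$ is assigned a real number $cost_i$ with $\sum_{i=1}^m cost_i=1$. Let $\lambda^*=\lambda_{k+1}(X)$ and $T=\lceil \operatorname{Tr}(M^*-X)\rceil$. Then there are absolute constants $c_1,c_2>0$ such that for every integer $N>8k$ there exist weights $w_1,\dots,w_m$, of which at most $N$ are nonzero, such that the matrix $M=X+\sum_{i=1}^m w_iY_i$ satisfies $$c_1\min(N/T,1)\cdot\lambda^*\cdot\lambda_{\min}(M^* )\le \lambda_{\min}(M)\le\lambda_{\max}(M)\le c_2,$$ and $\sum_{i=1}^m w_i\,cost_i\le \min(1,N/T)$.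
   Context: For a real symmetric $n\times n$ matrix $A$, $\lambda_{\min}(A)=\lambda_1(A)\le\lambda_2(A)\le\dots\le\lambda_n(A)=\lambda_{\max}(A)$ are its eigenvalues in increasing order. *)

(* Defs.v *)
From HB Require Import structures.
From mathcomp Require Import all_boot all_order all_algebra.
From mathcomp Require Import reals polyrcf.
Set Implicit Arguments. Unset Strict Implicit. Unset Printing Implicit Defensive.
Import Order.TTheory GRing.Theory Num.Theory.
Local Open Scope ring_scope.

Definition symmetricmx (R : realType) n (A : 'M[R]_n) : Prop := A^T = A.

Definition posdefmx (R : realType) n (A : 'M[R]_n) : Prop :=
  symmetricmx A /\ forall x : 'cV[R]_n, x != 0 -> 0 < (x^T *m A *m x) 0 0.

(* The eigenvalues of A (real roots of the characteristic polynomial,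
   listed with algebraic multiplicity) in increasing order.  For a real
   symmetric n x n matrix this list has exactly n entries. *)
Definition eigenvalues (R : realType) n (A : 'M[R]_n) : seq R :=
  let p := char_poly A in
  sort <=%R (flatten [seq nseq (mup x p) x | x <- rootsR p]).

(* lambda_i(A), 1-indexed: lambda_1 <= lambda_2 <= ... <= lambda_n. *)
Definition eig (R : realType) n (A : 'M[R]_n) (i : nat) : R :=
  nth 0 (eigenvalues A) i.-1.

Definition lambda_min (R : realType) n (A : 'M[R]_n) : R := eig A 1.
Definition lambda_max (R : realType) n (A : 'M[R]_n) : R := eig A n.

(* Main.v *)
(* A barrier argument in the style of Batson, Spielman and Srivastava.  Vectors are added
   one at a time, N/2 of them.  With Y = M* - X, the upper barrier is the weighted potential
   tr (Y (u - X - A)^-1), which is of order T and not n; the lower one lives on the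
   span of the k lowest eigenvectors of X (the rows of Q): with D = Q (X + A - l Y) Q^T it is
   tr (Q Y Q^T D^-1).  On the orthogonal complement of that span X itself is at least
   lambda_(k+1)(X), and the two bounds combine.

   Costs may be negative, so one cannot simply avoid expensive vectors by Markov's inequality.
   Instead vector i is drawn with probability P_i and given weight t / P_i, where P_i is
   chosen so large that the upper barrier is respected for every outcome.  The expected cost
   is then exactly linear in the number of steps, and the shift l of the lower barrier, which
   now depends on the outcome, grows by t/3 on average.  Two outcomes have an average
   that meets both the mean cost and the mean shift, and the spectral bounds survive averaging;
   this doubles the support to at most N. *)
Require Import Defs.
From HB Require Import structures.
From mathcomp Require Import all_boot all_order all_algebra all_fingroup.
From mathcomp Require Import reals polyrcf complex zify ring lra.
Import Order.TTheory GRing.Theory Num.Theory.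
Local Open Scope ring_scope.
Set Implicit Arguments.
Unset Strict Implicit.
Unset Printing Implicit Defensive.

(** * The spectral theorem *)

Lemma entryD (V : nmodType) m n (A B : 'M[V]_(m, n)) i j : (A + B) i j = A i j + B i j.
Proof. by rewrite mxE. Qed.

Lemma entryB (V : zmodType) m n (A B : 'M[V]_(m, n)) i j : (A - B) i j = A i j - B i j.
Proof. by rewrite !mxE. Qed.

Lemma entryZ (R : pzRingType) m n a (A : 'M[R]_(m, n)) i j : (a *: A) i j = a * A i j.
Proof. by rewrite mxE. Qed.

Lemma entry_tr (T : Type) m n (A : 'M[T]_(m, n)) i j : A^T i j = A j i.
Proof. by rewrite mxE. Qed.

(** Over the complex numbers an eigenvector with real part [x] and imaginary part [y] exists.
    Symmetry makes [x A y^T] and [y A x^T] agree, which forces [Im a * (|x|^2 + |y|^2) = 0]. So the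
    eigenvalue is real, and whichever of [x], [y] is nonzero is a real eigenvector. *)
Lemma sym_eigenvector (R : rcfType) n (A : 'M[R]_n.+1) : A^T = A ->
  exists a (u : 'rV[R]_n.+1), u != 0 /\ u *m A = a *: u.
Proof.
move=> AT.
have [a /eigenvalueP[v vA v0]] := eigenvalue_closed (map_mx (real_complex R) A) (ltn0Sn n).
pose x := map_mx (@complex.Re R) v; pose y := map_mx (@complex.Im R) v.
have xA : x *m A = complex.Re a *: x - complex.Im a *: y.
  apply/rowP => j; move/rowP/(_ j)/(congr1 (@complex.Re R)): vA.
  rewrite !mxE raddf_sum /= => H.
  transitivity (complex.Re (a * v 0 j)); last by case: a {H} => a b; case: (v 0 j).
  rewrite -H; apply: eq_bigr => i _; rewrite !mxE.
  by case: (v 0 i) => c d /=; rewrite ?mulr0 ?subr0 ?add0r.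
have yA : y *m A = complex.Im a *: x + complex.Re a *: y.
  apply/rowP => j; move/rowP/(_ j)/(congr1 (@complex.Im R)): vA.
  rewrite !mxE raddf_sum /= => H.
  transitivity (complex.Im (a * v 0 j)); last first.
    by case: a {xA H} => a b; case: (v 0 j) => c d /=; rewrite addrC.
  rewrite -H; apply: eq_bigr => i _; rewrite !mxE.
  by case: (v 0 i) => c d /=; rewrite ?mulr0 ?subr0 ?add0r.
have xy : x *m A *m y^T = (y *m A *m x^T)^T.
  by rewrite !trmx_mul trmxK AT mulmxA.
have sq (z : 'rV[R]_n.+1) : (z *m z^T) 0 0 = \sum_i z 0 i ^+ 2.
  by rewrite !mxE; apply: eq_bigr => i _; rewrite !mxE expr2.
have sq0 (z : 'rV[R]_n.+1) : \sum_i z 0 i ^+ 2 = 0 -> z = 0.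
  move=> H; apply/rowP => i; rewrite mxE; apply/eqP.
  rewrite -(sqrf_eq0 (z 0 i)).
  by move/eqP: H; rewrite psumr_eq0 => [/allP/(_ i)/= ->|j _]; rewrite ?mem_index_enum // sqr_ge0.
have sqge (z : 'rV[R]_n.+1) : 0 <= \sum_i z 0 i ^+ 2.
  by apply: sumr_ge0 => i _; rewrite sqr_ge0.
have vxy : x = 0 -> y = 0 -> False.
  move=> x0 y0; case/eqP: v0; apply/rowP => i; rewrite mxE.
  move/rowP/(_ i): x0; move/rowP/(_ i): y0; rewrite !mxE.
  by case: (v 0 i) => c d /= -> ->.
have b0 : complex.Im a = 0.
  move/matrixP/(_ 0 0): xy; rewrite xA yA.
  have yx : (y *m x^T) 0 0 = (x *m y^T) 0 0.
    have -> : y *m x^T = (x *m y^T)^T by rewrite trmx_mul trmxK.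
    by rewrite entry_tr.
  rewrite entry_tr mulmxBl mulmxDl -!scalemxAl entryB entryD !entryZ yx !sq => H.
  have {}H : complex.Im a * (\sum_i x 0 i ^+ 2 + \sum_i y 0 i ^+ 2) = 0.
    rewrite mulrDr; move: H; set s := (x *m y^T) 0 0 => H; lra.
  move/eqP: H; rewrite mulf_eq0 => /orP[/eqP //|].
  rewrite paddr_eq0 // => /andP[/eqP /sq0 x0 /eqP /sq0 y0]; by case: vxy.
exists (complex.Re a); move: xA yA; rewrite b0 !scale0r subr0 add0r => xA yA.
have [x0|x0] := eqVneq x 0; last by exists x.
exists y; split=> //; apply/eqP => y0; exact: vxy.
Qed.
Lemma row_dot_gt0 (R : realFieldType) n (u : 'rV[R]_n) : u != 0 -> 0 < (u *m u^T) 0 0.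
Proof.
move=> u0; have -> : (u *m u^T) 0 0 = \sum_i u 0 i ^+ 2.
  by rewrite mxE; apply: eq_bigr => i _; rewrite mxE expr2.
rewrite lt_def sumr_ge0 ?andbT => [|i _]; last exact: sqr_ge0.
apply: contra u0; rewrite psumr_eq0 => [/allP H|i _]; last exact: sqr_ge0.
apply/eqP/rowP => i; rewrite mxE; apply/eqP.
by rewrite -sqrf_eq0; apply: H; rewrite mem_index_enum.
Qed.

(** Being symmetric and its own inverse, [H] can conjugate a symmetric matrix so as to split off the
    eigenvector [u]. *)
Lemma reflection_to_e0 (R : rcfType) n (u : 'rV[R]_n.+1) : (u *m u^T) 0 0 = 1 ->
  exists H : 'M[R]_n.+1, [/\ H^T = H, H *m H = 1%:M & delta_mx 0 0 *m H = u].
Proof.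
move=> uu; pose e : 'rV[R]_n.+1 := delta_mx 0 0; rewrite -/e.
have eu : (e *m u^T) 0 0 = u 0 0 by rewrite -rowE !mxE.
have ee : (e *m e^T) 0 0 = 1 by rewrite -rowE !mxE !eqxx.
have ue : (u *m e^T) 0 0 = u 0 0.
  have -> : u *m e^T = (e *m u^T)^T by rewrite trmx_mul trmxK.
  by rewrite entry_tr.
have [->|ne] := eqVneq u e; first by exists 1%:M; rewrite trmx1 mulmx1 mulmx1.
pose h := e - u; have h0 : h != 0 by rewrite subr_eq0 eq_sym.
have hh := row_dot_gt0 h0; pose s := (h *m h^T) 0 0.
have sE : s = 2 - 2 * u 0 0.
  rewrite /s /h linearB /= mulmxBl !mulmxBr.
  by rewrite !entryB ee eu ue uu; ring.
have hhs : h *m h^T = s%:M by rewrite [LHS]mx11_scalar.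
have eh : e *m h^T = (s / 2)%:M.
  rewrite [LHS]mx11_scalar; congr (_ %:M).
  by rewrite /h linearB /= mulmxBr entryB ee eu sE; field.
(* the Householder reflection along [h] *)
exists (1%:M - (2 / s) *: (h^T *m h)); split.
- by rewrite linearB linearZ /= trmx1 trmx_mul trmxK.
- rewrite mulmxBl [X in _ - X](mulmxBr _ 1%:M) !mulmx1 mul1mx -scalemxAl -scalemxAr.
  have -> : h^T *m h *m (h^T *m h) = s *: (h^T *m h).
    by rewrite mulmxA -(mulmxA h^T) hhs mul_mx_scalar -scalemxAl.
  rewrite !scalerA [_ * s](_ : _ = 2 * (2 / s)); last by field; rewrite gt_eqF.
  apply/matrixP => i j; rewrite !mxE; lra.
- rewrite mulmxBr mulmx1 -scalemxAr mulmxA eh mul_scalar_mx scalerA.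
  rewrite [_ * _](_ : _ = 1); last by field; rewrite gt_eqF.
  by rewrite scale1r /h opprB addrC subrK.
Qed.

(** Deflation: after conjugation by a reflection taking a unit eigenvector to the first basis
    vector, the first row is [a] times that basis vector. By symmetry so is the first column, and
    induction handles the remaining diagonal block. *)
Lemma sym_spectral (R : rcfType) n (A : 'M[R]_n) : A^T = A ->
  exists (Q : 'M[R]_n) (d : 'rV[R]_n), Q *m Q^T = 1%:M /\ A = Q^T *m diag_mx d *m Q.
Proof.
elim: n A => [|n IH] A AT.
  by exists 1%:M, 0; split; apply/matrixP => -[].
have [a [v [v0 vA]]] := sym_eigenvector AT.
have vv := row_dot_gt0 v0; pose c := Num.sqrt ((v *m v^T) 0 0).
have c0 : 0 < c by rewrite sqrtr_gt0.
pose u := c^-1 *: v.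
have uA : u *m A = a *: u by rewrite -scalemxAl vA !scalerA mulrC.
have uu : (u *m u^T) 0 0 = 1.
  rewrite linearZ /= -scalemxAl -scalemxAr scalerA entryZ -invfM -expr2 sqr_sqrtr ?ltW //.
  by rewrite mulVf // gt_eqF.
have [H [HT HH Hu]] := reflection_to_e0 uu.
pose B : 'M[R]_(1 + n) := H *m A *m H.
have BT : B^T = B by rewrite /B !trmx_mul HT AT mulmxA.
have uH : u *m H = delta_mx 0 0 by rewrite -Hu -mulmxA HH mulmx1.
have B0 j : B 0 j = a * (j == 0)%:R.
  have : row 0 B = a *: delta_mx 0 0.
    by rewrite rowE /B !mulmxA Hu uA -scalemxAl uH.
  by move/rowP/(_ j); rewrite !mxE eqxx.
have AB : A = H *m B *m H.
  by rewrite /B !mulmxA HH mul1mx -mulmxA HH mulmx1.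
clearbody B; have l0 : @lshift 1 n 0 = 0 by apply/val_inj.
have BE : B = block_mx a%:M 0 0 (drsubmx B).
  rewrite -[LHS]submxK; congr block_mx.
  - by apply/matrixP => i j; rewrite !ord1 !mxE l0 [LHS]B0 mulr1.
  - by apply/matrixP => i j; rewrite !ord1 !mxE l0 [LHS]B0 mulr0.
  - by apply/matrixP => i j; rewrite !ord1 !mxE l0 -BT entry_tr [LHS]B0 mulr0.
have [|Q [d [QQ dE]]] := IH (drsubmx B).
  by rewrite trmx_drsub BT.
pose Q1 : 'M[R]_(1 + n) := block_mx 1%:M 0 0 Q.
have Q1T : Q1^T = block_mx 1%:M 0 0 Q^T by rewrite tr_block_mx !trmx0 trmx1.
have QQ1 : Q1 *m Q1^T = 1%:M.
  rewrite Q1T mulmx_block !mulmx0 !mul0mx !addr0 add0r mulmx1 QQ.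
  by rewrite -scalar_mx_block.
have DD : Q1^T *m diag_mx (row_mx a%:M d) *m Q1 = B.
  rewrite [RHS]BE dE diag_mx_row Q1T !mulmx_block.
  rewrite !mulmx0 !mul0mx !addr0 !add0r !mulmx1 !mul1mx; congr block_mx; rewrite ?mul0mx ?mulmx0 //.
  by apply/matrixP => i j; rewrite !ord1 !mxE eqxx.
clearbody Q1; exists (Q1 *m H), (row_mx a%:M d : 'rV_(1 + n)); split.
  by rewrite trmx_mul HT mulmxA -(mulmxA Q1) HH mulmx1.
by rewrite AB -DD trmx_mul HT !mulmxA.
Qed.
Lemma char_poly_orthodiag (R : comNzRingType) n (Q : 'M[R]_n) (d : 'rV[R]_n) :
  Q *m Q^T = 1%:M -> char_poly (Q^T *m diag_mx d *m Q) = \prod_(i < n) ('X - (d 0 i)%:P).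
Proof.
move=> QQ; have QQ' := mulmx1C QQ.
rewrite -[RHS](_ : char_poly (diag_mx d) = _); last first.
  rewrite char_poly_trig ?diag_mx_is_trig //; apply: eq_bigr => i _.
  by rewrite mxE eqxx.
rewrite /char_poly /char_poly_mx; pose P := map_mx polyC Q.
have PP : P^T *m P = 1%:M by rewrite /P map_trmx -map_mxM QQ' map_mx1.
have -> : 'X%:M - map_mx polyC (Q^T *m diag_mx d *m Q) =
    P^T *m ('X%:M - map_mx polyC (diag_mx d)) *m P.
  rewrite mulmxBr mulmxBl mul_mx_scalar -scalemxAl PP scalemx1.
  by rewrite !map_mxM -map_trmx.
rewrite !det_mulmx mulrC mulrA -det_mulmx mulmx1C // det1 mul1r //.
Qed.

Lemma mup_prod_XsubC (R : fieldType) (s : seq R) x :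
  mup x (\prod_(a <- s) ('X - a%:P)) = count_mem x s.
Proof.
elim: s => [|a s IH]; first by rewrite big_nil /= mupNroot // root1.
rewrite big_cons mupM ?IH ?polyXsubC_eq0 //=; last first.
  by rewrite (monic_neq0 (monic_prod_XsubC _ _ _)).
by rewrite -['X - a%:P]expr1 mup_XsubCX eq_sym; case: (x == a).
Qed.

(** The multiplicity of a root of a product of linear factors is its number of occurrences among the
    [d 0 i], so listing each root with multiplicity only regroups the diagonal. *)
Lemma eigenvalues_orthodiag (R : realType) n (Q : 'M[R]_n) (d : 'rV[R]_n) :
  Q *m Q^T = 1%:M ->
  perm_eq (eigenvalues (Q^T *m diag_mx d *m Q)) [seq d 0 i | i : 'I_n].
Proof.
move=> QQ; rewrite /eigenvalues perm_sort (char_poly_orthodiag d QQ).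
set s := [seq d 0 i | i : 'I_n].
have -> : \prod_(i < n) ('X - (d 0 i)%:P) = \prod_(a <- s) ('X - a%:P).
  by rewrite /s big_map enumT.
set p := \prod_(a <- s) _.
have p0 : p != 0 by rewrite (monic_neq0 (monic_prod_XsubC _ _ _)).
rewrite -(permPr (perm_count_undup s)); apply: perm_flatten.
rewrite (eq_map (g := fun x => nseq (count_mem x s) x)) => [|x]; last first.
  by rewrite mup_prod_XsubC.
apply/perm_map/uniq_perm; rewrite ?uniq_roots ?undup_uniq // => x.
by rewrite mem_undup -(roots_on_rootsR p0) root_prod_XsubC.
Qed.

Lemma sym_spectral_eig (R : realType) n (A : 'M[R]_n) : A^T = A ->
  size (eigenvalues A) = n /\
  exists Q : 'M[R]_n, Q *m Q^T = 1%:M /\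
    A = Q^T *m diag_mx (\row_i eig A i.+1) *m Q.
Proof.
move=> AT; have [Q [d [QQ AE]]] := sym_spectral AT.
have := eigenvalues_orthodiag d QQ; rewrite -AE => P.
have sz : size (eigenvalues A) = n by rewrite (perm_size P) size_map size_enum_ord.
split=> //.
have P' : perm_eq (eigenvalues A) [tuple d 0 i | i < n] by [].
have /tuple_permP[p pE] := P'.
have eE (i : 'I_n) : eig A i.+1 = d 0 (p i).
  rewrite /eig /= pE /= (nth_map i) ?size_enum_ord // nth_ord_enum.
  by rewrite tnth_mktuple.
(* Permuting the eigenvectors by [p] puts the diagonal into increasing order. *)
exists (row_perm p Q); split.
  apply/matrixP => i j; move/matrixP/(_ (p i) (p j)): QQ.
  rewrite !mxE (inj_eq perm_inj) => <-; apply: eq_bigr => k _; by rewrite !mxE.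
rewrite {1}AE; apply/matrixP => i j; rewrite !mxE (reindex_inj (@perm_inj _ p)) /=.
apply: eq_bigr => k _; rewrite !mul_mx_diag !mxE eE //.
Qed.
(** * Quadratic forms *)

Definition bf (R : pzRingType) n (A : 'M[R]_n) (x y : 'cV[R]_n) : R := (x^T *m A *m y) 0 0.
Definition dot (R : pzRingType) n (x y : 'cV[R]_n) : R := (x^T *m y) 0 0.
Definition psd (R : realType) n (A : 'M[R]_n) : Prop :=
  A^T = A /\ forall x, 0 <= bf A x x.

Section Bilinear.
Variables (R : comPzRingType) (n : nat).
Implicit Types (A B : 'M[R]_n) (x y z : 'cV[R]_n).

Lemma bfDl A x y z : bf A (x + y) z = bf A x z + bf A y z.
Proof. by rewrite /bf linearD /= !mulmxDl entryD. Qed.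
Lemma bfDr A x y z : bf A z (x + y) = bf A z x + bf A z y.
Proof. by rewrite /bf mulmxDr entryD. Qed.
Lemma bfZl A a x y : bf A (a *: x) y = a * bf A x y.
Proof. by rewrite /bf linearZ /= -!scalemxAl entryZ. Qed.
Lemma bfZr A a x y : bf A x (a *: y) = a * bf A x y.
Proof. by rewrite /bf -scalemxAr entryZ. Qed.
Lemma bfD A B x y : bf (A + B) x y = bf A x y + bf B x y.
Proof. by rewrite /bf mulmxDr mulmxDl entryD. Qed.
Lemma bfB A B x y : bf (A - B) x y = bf A x y - bf B x y.
Proof. by rewrite /bf mulmxBr mulmxBl entryB. Qed.
Lemma bfZ a A x y : bf (a *: A) x y = a * bf A x y.
Proof. by rewrite /bf -scalemxAr -scalemxAl entryZ. Qed.
Lemma bf_sum (I : finType) (F : I -> 'M[R]_n) x y :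
  bf (\sum_i F i) x y = \sum_i bf (F i) x y.
Proof. by rewrite /bf mulmx_sumr mulmx_suml summxE. Qed.
Lemma bfC A x y : A^T = A -> bf A x y = bf A y x.
Proof. by move=> AT; rewrite /bf -entry_tr !trmx_mul trmxK AT mulmxA. Qed.
Lemma dotC x y : dot x y = dot y x.
Proof. by rewrite /dot -entry_tr trmx_mul trmxK. Qed.
Lemma bf_dot A x y : bf A x y = dot x (A *m y).
Proof. by rewrite /bf /dot mulmxA. Qed.
Lemma bf1 x y : bf 1%:M x y = dot x y.
Proof. by rewrite bf_dot mul1mx. Qed.
Lemma bf_scalar a x y : bf a%:M x y = a * dot x y.
Proof. by rewrite -scalemx1 bfZ bf1. Qed.
Lemma bf_outer v x y : bf (v *m v^T) x y = dot v x * dot v y.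
Proof.
by rewrite [dot v x]dotC /bf /dot !mulmxA -mulmxA mxE big_ord1.
Qed.
Lemma bf_conj m (P : 'M[R]_(n, m)) A (x y : 'cV[R]_m) :
  bf (P^T *m A *m P) x y = bf A (P *m x) (P *m y).
Proof. by rewrite /bf trmx_mul !mulmxA. Qed.
Lemma bf_mull A B x y : A^T = A -> bf (A *m B) x y = bf B (A *m x) y.
Proof. by move=> AT; rewrite /bf trmx_mul AT !mulmxA. Qed.
Lemma bf_mulr A B x y : bf (A *m B) x y = bf A x (B *m y).
Proof. by rewrite /bf !mulmxA. Qed.
Lemma tr_outer A v : \tr (v *m v^T *m A) = bf A v v.
Proof. by rewrite -mulmxA mxtrace_mulC /bf trace_mx11. Qed.
Lemma tr_gram m (v : 'I_m -> 'cV[R]_n) A :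
  \tr ((\sum_i v i *m (v i)^T) *m A) = \sum_i bf A (v i) (v i).
Proof. by rewrite mulmx_suml raddf_sum /=; apply: eq_bigr => i _; rewrite tr_outer. Qed.
Lemma tr_gram_sym m (v : 'I_m -> 'cV[R]_n) :
  (\sum_i v i *m (v i)^T)^T = \sum_i v i *m (v i)^T.
Proof. by rewrite raddf_sum /=; apply: eq_bigr => i _; rewrite trmx_mul trmxK. Qed.
End Bilinear.

Section Definite.
Variable R : realType.

Lemma dot_ge0 n (x : 'cV[R]_n) : 0 <= dot x x.
Proof. by rewrite /dot mxE sumr_ge0 // => i _; rewrite mxE -expr2 sqr_ge0. Qed.

Lemma dot_gt0 n (x : 'cV[R]_n) : x != 0 -> 0 < dot x x.
Proof.
move=> x0; rewrite /dot -[in X in _ < X](trmxK x) trmxK.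
have := @row_dot_gt0 R n x^T; rewrite trmxK; apply.
by rewrite -(inj_eq (@trmx_inj _ _ _)) trmxK trmx0.
Qed.

Lemma posdef_psd n (A : 'M[R]_n) : posdefmx A -> psd A.
Proof.
move=> [AT A0]; split=> // x; have [->|x0] := eqVneq x 0; last exact/ltW/A0.
by rewrite /bf mulmx0 mxE.
Qed.

Lemma posdef_unit n (A : 'M[R]_n) : posdefmx A -> A \in unitmx.
Proof.
move=> [AT A0]; rewrite -row_free_unit -kermx_eq0; apply/eqP/row_matrixP => i.
rewrite row0; set u := row i _; have uA : u *m A = 0.
  by rewrite /u -row_mul mulmx_ker row0.
apply/eqP/negP => /negP u0.
have /A0 : u^T != 0 by rewrite -(inj_eq (@trmx_inj _ _ _)) trmxK trmx0.
by rewrite trmxK uA mul0mx mxE ltxx.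
Qed.

Lemma posdef_inv n (A : 'M[R]_n) : posdefmx A -> posdefmx (invmx A).
Proof.
move=> Ap; have [AT A0] := Ap; have Au := posdef_unit Ap.
have iT : (invmx A)^T = invmx A by rewrite trmx_inv AT.
split=> // x x0; rewrite -/(bf _ _ _).
have -> : bf (invmx A) x x = bf A (invmx A *m x) (invmx A *m x).
  by rewrite -bf_mull // mulVmx // bf1 bf_dot.
apply: A0; apply: contra x0 => /eqP H.
by rewrite -[x](mulKVmx Au) H mulmx0.
Qed.

Lemma psd_CS n (A : 'M[R]_n) x y : psd A ->
  bf A x y ^+ 2 <= bf A x x * bf A y y.
Proof.
move=> [AT A0].
have H a b : 0 <= a ^+ 2 * bf A x x + 2 * (a * b) * bf A x y + b ^+ 2 * bf A y y.
  have := A0 (a *: x + b *: y).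
  by rewrite !bfDl !bfDr !bfZl !bfZr [bf A y x]bfC //; congr (_ <= _); ring.
have [y0|y0] := eqVneq (bf A y y) 0.
  have [x0|x0] := eqVneq (bf A x y) 0; first by rewrite x0 y0 mulr0 expr0n.
  (* With these coefficients the form takes the value -1, which is impossible. *)
  have := H 1 (- (bf A x x + 1) / (2 * bf A x y)); rewrite y0 mulr0 addr0.
  have -> : 2 * (1 * (- (bf A x x + 1) / (2 * bf A x y))) * bf A x y = - (bf A x x + 1).
    by field.
  lra.
have yp : 0 < bf A y y by rewrite lt_def y0 A0.
have := H (bf A y y) (- bf A x y) => {}H; rewrite -(ler_pM2l yp).
nra.
Qed.

(** Cauchy-Schwarz for the form of [D], applied to [z] and [invmx D *m h]. *)
Lemma posdef_CS n (D : 'M[R]_n) z h : posdefmx D ->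
  dot z h ^+ 2 <= bf D z z * bf (invmx D) h h.
Proof.
move=> Dp; have Du := posdef_unit Dp; have [DT _] := posdef_inv Dp.
have := psd_CS z (invmx D *m h) (posdef_psd Dp).
rewrite bf_dot mulKVmx //; congr (_ <= _ * _).
by rewrite -bf_mull // mulVmx // bf1 bf_dot.
Qed.

(** Put [z = invmx D' *m x]; the left side and [bf D' z z] both equal [dot z x]. Then [posdef_CS]
    bounds [(dot z x)^2] by [c * dot z x * bf (invmx D) x x], and one factor [dot z x] cancels. *)
Lemma inv_antitone n (D D' : 'M[R]_n) c : posdefmx D -> posdefmx D' -> 0 <= c ->
  (forall z, bf D z z <= c * bf D' z z) ->
  forall x, bf (invmx D') x x <= c * bf (invmx D) x x.
Proof.
move=> Dp D'p c0 DD x; have D'u := posdef_unit D'p.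
have [x0|x0] := eqVneq x 0; first by rewrite x0 /bf !mulmx0 !mxE mulr0.
pose z := invmx D' *m x.
have zx : bf (invmx D') x x = dot z x by rewrite bf_dot dotC.
have zz : bf D' z z = dot z x by rewrite bf_dot mulKVmx.
have p0 : 0 < dot z x by rewrite -zx; apply: (posdef_inv D'p).2.
have q0 := (posdef_psd (posdef_inv Dp)).2 x.
have := posdef_CS z x Dp => H; have := DD z; rewrite zz zx => H'.
rewrite -(ler_pM2l p0); apply: le_trans (_ : _ <= _) _; first by rewrite -expr2.
  by apply: le_trans H _; rewrite mulrA (mulrC _ c); apply: ler_wpM2r.
Qed.

Lemma sherman_morrison n (D : 'M[R]_n) y s : posdefmx D -> 1 + s * bf (invmx D) y y != 0 ->
  invmx (D + s *: (y *m y^T)) =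
    invmx D - (s / (1 + s * bf (invmx D) y y)) *: (invmx D *m y *m y^T *m invmx D).
Proof.
move=> Dp; set C := invmx D; set r := bf C y y => r0; have Du := posdef_unit Dp.
set E := C - _; suff H : (D + s *: (y *m y^T)) *m E = 1%:M.
  have [Hu _] := mulmx1_unit H.
  by rewrite -[LHS]mulmx1 -H mulKmx.
rewrite /E mulmxBr !mulmxDl mulmxV // -!scalemxAr -!scalemxAl !mulmxA mulmxV // mul1mx.
have -> : y *m y^T *m C *m y = r *: y.
  by rewrite -!mulmxA (mulmxA y^T) [y^T *m C *m y]mx11_scalar mul_mx_scalar.
rewrite -!scalemxAl -/C -addrA; apply/eqP; rewrite -subr_eq0 addrAC subrr add0r.
set G := y *m y^T *m C; rewrite !scalerA -scalerDl -scalerBl.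
by apply/eqP; rewrite [_ - _](_ : _ = 0) ?scale0r //; field.
Qed.

(** In an eigenbasis of [G] the trace is the sum of the eigenvalues of [G] times the diagonal
    entries of [C], all nonnegative. *)
Lemma psd_trace n (G C : 'M[R]_n) : psd G -> psd C -> 0 <= \tr (G *m C).
Proof.
move=> [GT G0] [CT C0]; have [Q [d [QQ GE]]] := sym_spectral GT.
rewrite GE -!mulmxA mxtrace_mulC -!mulmxA /mxtrace; apply: sumr_ge0 => i _.
have d0 : 0 <= d 0 i.
  have := G0 (Q^T *m delta_mx i 0).
  rewrite GE bf_conj mulmxA QQ mul1mx /bf trmx_delta -rowE -colE !mxE eqxx //.
rewrite mul_diag_mx mxE mulr_ge0 //.
have := C0 (Q^T *m delta_mx i 0); congr (_ <= _).
by rewrite -bf_conj trmxK /bf trmx_delta -rowE -colE mulmxA mxE mxE.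
Qed.

Lemma psd_gram n m (v : 'I_m -> 'cV[R]_n) : psd (\sum_i v i *m (v i)^T).
Proof.
split=> [|x]; first exact: tr_gram_sym.
by rewrite bf_sum sumr_ge0 // => i _; rewrite bf_outer -expr2 sqr_ge0.
Qed.
End Definite.
(** * Moving one barrier *)

Section Barriers.
Variable R : realType.

Lemma tr_inv_rank1 n (D Y : 'M[R]_n) v s : posdefmx D -> 1 + s * bf (invmx D) v v != 0 ->
  \tr (Y *m invmx (D + s *: (v *m v^T))) =
    \tr (Y *m invmx D) -
      s / (1 + s * bf (invmx D) v v) * bf Y (invmx D *m v) (invmx D *m v).
Proof.
move=> Dp r0; rewrite sherman_morrison // mulmxBr linearB /= -scalemxAr linearZ /=.
rewrite -[bf Y _ _]tr_outer trmx_mul trmx_inv (proj1 Dp) [\tr (_ *m Y)]mxtrace_mulC.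
by rewrite !mulmxA.
Qed.

Lemma bf_gram n m (v : 'I_m -> 'cV[R]_n) x y :
  bf (\sum_i v i *m (v i)^T) x y = \sum_i dot (v i) x * dot (v i) y.
Proof. by rewrite bf_sum; apply: eq_bigr => i _; rewrite bf_outer. Qed.

Lemma gram_ge n m (v : 'I_m -> 'cV[R]_n) x i :
  dot (v i) x ^+ 2 <= bf (\sum_i v i *m (v i)^T) x x.
Proof.
rewrite bf_gram (bigD1 i) //= -expr2 lerDl sumr_ge0 // => j _.
by rewrite -expr2 sqr_ge0.
Qed.

(** Here [D] is the gap below the upper barrier. Raising the barrier by [dl] lowers the potential by
    [dl * h]; adding [w] times vector [i] raises it by [w * g i / (1 - w * r i)]. The rise is
    covered as soon as [w * (g i / (dl * h) + r i) <= 1], which defines [U]. Since [Y <= 1], the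
    [g i] sum to at most [h], and the [r i] sum to at most [phi]. *)
Lemma upper_step n m (v : 'I_m -> 'cV[R]_n) (D : 'M[R]_n) dl phi i0 :
  let Y := \sum_i v i *m (v i)^T in
  posdefmx D -> (forall z, bf Y z z <= dot z z) -> v i0 != 0 -> 0 < dl ->
  \tr (Y *m invmx D) <= phi ->
  exists U : 'I_m -> R, [/\ forall i, 0 <= U i, \sum_i U i <= dl^-1 + phi &
    forall i w, 0 <= w -> w * U i <= 1 ->
      let D' := D + dl%:M - w *: (v i *m (v i)^T) in
      posdefmx D' /\ \tr (Y *m invmx D') <= phi].
Proof.
move=> Y Dp Y1 vi0 dl0 trD; pose Dd := D + dl%:M.
have Ddp : posdefmx Dd.
  split=> [|x x0]; first by rewrite /Defs.symmetricmx /Dd  linearD /= tr_scalar_mx (proj1 Dp).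
  by rewrite -/(bf _ _ _) bfD bf_scalar addr_gt0 ?mulr_gt0 ?dot_gt0 //; apply: (proj2 Dp).
pose B := invmx D; pose E := invmx Dd.
have Du := posdef_unit Dp; have Ddu := posdef_unit Ddp.
have Bp := posdef_inv Dp; have Ep := posdef_inv Ddp.
have BE : B - E = dl *: (B *m E).
  have -> : B - E = B *m (Dd - D) *m E.
    by rewrite mulmxBr mulmxBl mulVmx // mul1mx -mulmxA mulmxV // mulmx1.
  by rewrite /Dd addrAC subrr add0r mul_mx_scalar -scalemxAl.
pose h := \sum_i bf (B *m E) (v i) (v i).
have trE : \tr (Y *m E) = \tr (Y *m B) - dl * h.
  by rewrite /h -tr_gram -/Y -linearZ /= scalemxAr -BE mulmxBr linearB /= subKr.
(* From [B v = z + dl B z] with [z = E v], the right side is [|z|^2] plus a nonnegative term. *)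
have hge i : dot (E *m v i) (E *m v i) <= bf (B *m E) (v i) (v i).
  set z := E *m v i; have vz : B *m v i = z + dl *: (B *m z).
    rewrite -[v i](mulKVmx Ddu) -/E -/z mulmxDl mulmxDr mulKmx //.
    by rewrite mul_scalar_mx -scalemxAr.
  rewrite bf_mulr -/z bfC ?(proj1 Bp) // bf_dot vz /dot mulmxDr entryD lerDl.
  by rewrite -scalemxAr entryZ mulmxA mulr_ge0 ?(ltW dl0) //; apply: (proj2 (posdef_psd Bp)).
pose g i := bf Y (E *m v i) (E *m v i).
have g0 i : 0 <= g i by apply: (proj2 (psd_gram v)).
have h0 : 0 < h.
  apply: lt_le_trans (_ : \sum_i dot (E *m v i) (E *m v i) <= _); last exact: ler_sum.
  rewrite (bigD1 i0) //= ltr_pwDl ?sumr_ge0 // => [|i _]; last exact: dot_ge0.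
  apply: dot_gt0; apply: contra vi0 => /eqP H.
  by rewrite -[v i0](mulKVmx Ddu) -/E H mulmx0.
have sg : \sum_i g i <= h by apply: ler_sum => i _; apply: le_trans (Y1 _) (hge i).
pose r i := bf E (v i) (v i).
have r0 i : 0 <= r i by apply: (proj2 (posdef_psd Ep)).
exists (fun i => g i / (dl * h) + r i); split=> [i||i w w0 wU].
- by rewrite addr_ge0 // divr_ge0 // mulr_ge0 // ltW.
- rewrite big_split /= -mulr_suml; apply: lerD.
    by rewrite ler_pdivrMr ?mulr_gt0 // mulKf ?gt_eqF.
  by rewrite -tr_gram -/Y trE; apply: le_trans trD; rewrite gerBl mulr_ge0 ?ltW.
(* Strictness keeps the new gap positive definite. It holds because [g i > 0] whenever [v i] is
   nonzero: [Y] dominates the outer square of [v i]. *)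
have wr : w * r i < 1.
  have [->|w1] := eqVneq w 0; first by rewrite mul0r.
  have wp : 0 < w by rewrite lt_def w1.
  have [v0|v0] := eqVneq (v i) 0; first by rewrite /r v0 /bf mulmx0 mxE mulr0.
  have rp : 0 < r i by apply: (proj2 Ep).
  have gp : 0 < g i.
    apply: lt_le_trans (gram_ge v (E *m v i) i).
    by rewrite exprn_gt0 // -bf_dot.
  apply: lt_le_trans wU; rewrite mulrDr ltrDr mulr_gt0 // divr_gt0 // mulr_gt0 //.
have D'E : D + dl%:M - w *: (v i *m (v i)^T) = Dd + (- w) *: (v i *m (v i)^T).
  by rewrite scaleNr.
rewrite D'E; split.
  split=> [|x x0].
    by rewrite /Defs.symmetricmx linearD linearZ /= trmx_mul trmxK (proj1 Ddp).
  rewrite -/(bf _ _ _) bfD bfZ bf_outer mulNr -expr2.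
  have := posdef_CS x (v i) Ddp; rewrite dotC -/E -/(r i) => H.
  have := proj2 Ddp x x0; rewrite -/(bf _ _ _) => H1.
  rewrite subr_gt0; apply: le_lt_trans (_ : w * (bf Dd x x * r i) < _).
    by apply: ler_wpM2l.
  by rewrite mulrCA gtr_pMr.
rewrite tr_inv_rank1 // -/E -/(r i) -/(g i); last by rewrite mulNr gt_eqF // subr_gt0.
rewrite mulNr mulNr mulNr opprK trE -addrA; apply: le_trans trD; rewrite gerDl addrC subr_le0.
rewrite mulrAC ler_pdivrMr ?subr_gt0 //.
have dh : 0 < dl * h by rewrite mulr_gt0.
rewrite mulrBr mulr1 lerBrDr -(ler_pM2l (_ : 0 < (dl * h)^-1)) ?invr_gt0 //.
rewrite mulVf ?gt_eqF // mulrDr mulKf ?gt_eqF //.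
by rewrite mulrDr in wU; rewrite mulrCA [_^-1 * _]mulrC.
Qed.

Lemma psd_conj n (S C : 'M[R]_n) : S^T = S -> psd C -> psd (S *m C *m S).
Proof.
move=> ST [CT C0]; split=> [|x]; first by rewrite !trmx_mul ST CT mulmxA.
by rewrite -{1}ST bf_conj.
Qed.

(** Adding [w] times vector [i] lowers the potential by [w * G / (1 + w * r i)], at least
    [w * G / 2] as [w * r i <= 1]. Shifting by [dl = w * G / (3 * k2)] removes at most a third of
    [D], so the new inverse is at most [3/2] of the old one and the potential rises by at most
    [dl * (3/2 * k2) = w * G / 2]. The quotients [g i = G / k2] sum to 1, which fixes the mean
    shift. *)
Lemma lower_step k m (y : 'I_m -> 'cV[R]_k) (D : 'M[R]_k) p :
  let Y := \sum_i y i *m (y i)^T in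
  (0 < m)%N -> posdefmx D -> \tr (Y *m invmx D) <= p ->
  exists r g : 'I_m -> R, [/\ forall i, 0 <= r i, \sum_i r i <= p, \sum_i g i = 1 &
    forall i w, 0 <= w -> w * r i <= 1 ->
      let D' := D + w *: (y i *m (y i)^T) - (w * g i / 3) *: Y in
      posdefmx D' /\ \tr (Y *m invmx D') <= p].
Proof.
move=> Y m0 Dp trD; set C := invmx D; have Du := posdef_unit Dp.
have [DT D0] := Dp; have Cp := posdef_inv Dp; rewrite -/C in Cp; have [CT C0] := Cp.
have [YT Y0] := psd_gram y; rewrite -/Y in YT Y0.
have Cs := posdef_psd Cp; have Ds := posdef_psd Dp.
pose k2 := \tr (Y *m C *m Y *m C).
have k2E : k2 = \sum_i bf Y (C *m y i) (C *m y i).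
  rewrite /k2 -!mulmxA tr_gram; apply: eq_bigr => i _.
  by rewrite bf_mull // bf_mulr.
(* [k2] is the squared Frobenius norm of [C^(1/2) Y C^(1/2)], hence [Y <= sqrt k2 *: D]; the
   square root is avoided by testing [z z^T <= bf D z z *: C] against [Y C Y]. *)
have key z : bf Y z z ^+ 2 <= k2 * bf D z z ^+ 2.
  have s0 := Ds.2 z; set s := bf D z z in s0 *.
  have : 0 <= \tr (Y *m C *m Y *m (s *: C - z *m z^T)).
    apply: psd_trace; first exact: psd_conj.
    split=> [|x]; first by rewrite linearB linearZ /= CT trmx_mul trmxK.
    rewrite bfB bfZ bf_outer -expr2 dotC subr_ge0 dotC; exact: posdef_CS.
  rewrite mulmxBr linearB -scalemxAr linearZ /= -/k2 subr_ge0.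
  rewrite [X in X <= _]mxtrace_mulC tr_outer bf_mulr bf_mull // => H.
  have := posdef_CS z (Y *m z) Dp; rewrite -bf_dot -/C -/s => /le_trans; apply.
  by rewrite mulrC [s ^+ 2]expr2 mulrA; apply: ler_wpM2r => //; rewrite mulrC.
have k20 : 0 <= k2 by rewrite k2E sumr_ge0.
pose r i := bf C (y i) (y i).
have rp : \sum_i r i <= p by rewrite -tr_gram.
have r0 i : 0 <= r i by apply: Cs.2.
(* If [k2 = 0] then all [y i] and [Y] vanish, so any shift is harmless; a uniform [g] supplies the
   required sum 1. *)
have [k0|kN0] := eqVneq k2 0.
  have y0 i : y i = 0.
    apply/eqP/negP => /negP yi; have := dot_gt0 yi; apply/negP; rewrite -leNgt.
    have := gram_ge y (y i) i; have := key (y i); rewrite k0 mul0r -/Y => H1 H2.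
    have H3 : bf Y (y i) (y i) = 0.
      by apply/eqP; rewrite -sqrf_eq0 eq_le H1 sqr_ge0.
    by move: H2; rewrite H3; nra.
  exists r, (fun=> m%:R^-1); split=> //.
    by rewrite sumr_const card_ord -[LHS]mulr_natr mulVf // pnatr_eq0 -lt0n.
  move=> i w _ _ D'; have YZ : Y = 0 by apply: big1 => j _; rewrite y0 mul0mx.
  have -> : D' = D by rewrite /D' YZ y0 mul0mx !scaler0 addr0 subr0.
  by [].
have kp : 0 < k2 by rewrite lt_def kN0.
exists r, (fun i => bf Y (C *m y i) (C *m y i) / k2); split=> //.
  by rewrite -mulr_suml -k2E divff.
move=> i w w0 wr D'; set G := bf Y _ _ in D' *; pose dl := w * (G / k2) / 3.
have G0 : 0 <= G by apply: Y0.
have dl0 : 0 <= dl by rewrite !mulr_ge0 ?invr_ge0.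
have DC : bf D (C *m y i) (C *m y i) = r i.
  by rewrite -bf_mull // mulVmx // bf1 dotC /r bf_dot dotC.
(* Multiply the instances of [key] at [z] and at [C *m y i], take square roots, and use
   [w * r i <= 1]. *)
have dlY z : dl * bf Y z z <= bf D z z / 3.
  have H1 := key z; have H2 := key (C *m y i); rewrite DC -/G in H2.
  have H : G * bf Y z z <= k2 * (r i * bf D z z).
    have a0 : 0 <= G * bf Y z z by apply: mulr_ge0.
    have b0 : 0 <= k2 * (r i * bf D z z) by rewrite !mulr_ge0 // Ds.2.
    rewrite -ler_sqr ?nnegrE // !exprMn [k2 ^+ 2]expr2 [X in _ <= X]mulrACA.
    by apply: ler_pM; rewrite ?sqr_ge0.
  have {}H : G / k2 * bf Y z z <= r i * bf D z z.
    by rewrite mulrAC ler_pdivrMr // [X in _ <= X]mulrC.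
  have := ler_wpM2l w0 H; rewrite mulrA => {}H.
  rewrite /dl mulrAC ler_pM2r ?invr_gt0 //.
  by apply: le_trans H _; rewrite mulrA ler_piMl ?Ds.2.
pose D1 := D + w *: (y i *m (y i)^T).
have D1ge z : bf D z z <= bf D1 z z.
  by rewrite bfD bfZ bf_outer -expr2 lerDl mulr_ge0 ?sqr_ge0.
have D1p : posdefmx D1.
  split=> [|z z0]; first by rewrite /Defs.symmetricmx /D1 linearD linearZ /= trmx_mul trmxK DT.
  by apply: lt_le_trans (D1ge z); apply: D0.
have D'E : D' = D1 - dl *: Y by [].
have D'ge z : bf D z z <= 3 / 2 * bf D' z z.
  have := D1ge z; have := dlY z; rewrite D'E bfB bfZ; lra.
have D'p : posdefmx D'.
  split=> [|z z0]; first by rewrite /Defs.symmetricmx D'E linearB linearZ /= YT (proj1 D1p).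
  have := D'ge z; have := D0 z z0; rewrite -!/(bf _ _ _); lra.
have D'u := posdef_unit D'p; have D1u := posdef_unit D1p.
split=> //; set E := invmx D'; pose C1 := invmx D1.
(* The resolvent identity turns the effect of the shift on the potential into
   [dl * \tr (Y *m C1 *m Y *m E)], which [T1] and [T2] bound. *)
have EE : E = C1 + dl *: (C1 *m Y *m E).
  rewrite -[LHS](mulKmx D1u) -/C1 -[D1](subrK (dl *: Y)) -D'E mulmxDl mulmxV //.
  by rewrite mulmxDr mulmx1 -scalemxAl -scalemxAr mulmxA.
have [ET E0] := posdef_psd (posdef_inv D'p); rewrite -/E in ET E0.
have [C1T _] := posdef_inv D1p; rewrite -/C1 in C1T.
have T1 : \tr (Y *m C1 *m Y *m E) <= \tr (Y *m C *m Y *m E).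
  rewrite -subr_ge0 -linearB /= -!mulmxBl -mulmxBr.
  rewrite -(mulmxA (Y *m _)) mxtrace_mulC mulmxA; apply: psd_trace; first exact: psd_conj.
  split=> [|z]; first by rewrite linearB /= CT C1T.
  rewrite bfB subr_ge0 -[X in _ <= X]mul1r; apply: inv_antitone => // x.
  by rewrite mul1r.
have T2 : \tr (Y *m C *m Y *m E) <= 3 / 2 * k2.
  rewrite -subr_ge0 /k2 -linearZ -linearB /= scalemxAr -mulmxBr.
  apply: psd_trace; first exact: psd_conj.
  split=> [|z]; first by rewrite linearB linearZ /= CT ET.
  by rewrite bfB bfZ subr_ge0; apply: inv_antitone => //; rewrite divr_ge0.
have wr1 : 0 < 1 + w * r i by rewrite ltr_pwDl // mulr_ge0.
have T0 : \tr (Y *m C1) = \tr (Y *m C) - w / (1 + w * r i) * G.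
  by rewrite tr_inv_rank1 -/C -/(r i) -?/G ?gt_eqF //.
rewrite EE mulmxDr linearD /= -scalemxAr linearZ /= !mulmxA T0.
apply: le_trans trD; rewrite -/C -addrA gerDl addrC subr_le0.
apply: le_trans (_ : dl * (3 / 2 * k2) <= _).
  by apply: ler_wpM2l => //; apply: le_trans T1 T2.
have -> : dl * (3 / 2 * k2) = w * G / 2 by rewrite /dl; field.
rewrite [X in _ <= X]mulrAC; apply: ler_wpM2l; first exact: mulr_ge0.
rewrite lef_pV2 ?posrE //; lra.
Qed.

End Barriers.
(** * Random processes and their averages *)

Lemma wsum_gt0 (R : realDomainType) (J : finType) (P : pred J) (p f : J -> R) :
  (forall i, 0 <= p i) -> (forall i, P i -> 0 < f i) -> 0 < \sum_(i | P i) p i ->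
  0 < \sum_(i | P i) p i * f i.
Proof.
move=> p0 f0 s0; have pf0 i : P i -> 0 <= p i * f i by move=> /f0 /ltW; apply: mulr_ge0.
rewrite lt_def sumr_ge0 // andbT; apply: contraTneq s0 => /eqP.
rewrite psumr_eq0 // => /allP H; rewrite big1 ?ltxx // => i Pi.
have := H i (mem_index_enum _); rewrite Pi mulf_eq0 (gt_eqF (f0 i Pi)) orbF.
by move/eqP.
Qed.

(** The mean of the points [(a i, b i)] lies in the quadrant below [(a0, b0)], so the quadrant meets
    their convex hull. If no single point is in it, some segment from a point with [b i <= b0] to
    one with [b0 < b j] crosses the line [b = b0] at or left of [a0]. *)
Lemma two_point_average (R : realFieldType) (J : finType) (p a b : J -> R) a0 b0 :
  (forall i, 0 <= p i) -> \sum_i p i = 1 ->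
  \sum_i p i * a i <= a0 -> \sum_i p i * b i <= b0 ->
  exists i j th, [/\ 0 <= th <= 1, th * a i + (1 - th) * a j <= a0 &
    th * b i + (1 - th) * b j <= b0].
Proof.
move=> p0 p1 sa sb.
have [/existsP[i /andP[ai bi]]|/existsPn noP] :=
    boolP [exists i, (a i <= a0) && (b i <= b0)].
  by exists i, i, 1; rewrite subrr !mul0r !mul1r !addr0 lexx ler01.
have {noP}aP i : b i <= b0 -> 0 < a i - a0.
  by move=> bi; have := noP i; rewrite bi andbT -ltNge subr_gt0.
have [/existsP[i /existsP[j /and3P[bi bj ab]]]|noQ] := boolP [exists i, exists j,
    [&& b i <= b0, b0 < b j & (a i - a0) * (b j - b0) <= (a j - a0) * (b i - b0)]].
  have d0 : 0 < b j - b i by lra.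
  (* This ratio makes the average of the two [b]-values exactly [b0]. *)
  exists i, j, ((b j - b0) / (b j - b i)); split.
  - by rewrite divr_ge0 ?ler_pdivrMr //=; lra.
  - rewrite -(ler_pM2l d0) mulrDr mulrA mulrCA.
    rewrite [X in X + _](_ : _ = (b j - b0) * a i); last by field; rewrite gt_eqF.
    rewrite [X in _ + X](_ : _ = (b0 - b i) * a j); last by field; rewrite gt_eqF.
    nra.
  - rewrite -(ler_pM2l d0) [X in X <= _](_ : _ = (b j - b i) * b0) //.
    by field; rewrite gt_eqF.
exfalso.
(* Otherwise all determinants [pos] are positive, but their [p i * p j]-weighted sum,
   [A * B' - A' * B], is not. *)
have {noQ}pos i j : b i <= b0 -> b0 < b j ->
    0 < (a i - a0) * (b j - b0) - (a j - a0) * (b i - b0).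
  move=> bi bj; rewrite subr_gt0 ltNge; apply: contra noQ => H.
  by apply/existsP; exists i; apply/existsP; exists j; rewrite bi bj H.
pose P i := b i <= b0.
pose A := \sum_(i | P i) p i * (a i - a0); pose A' := \sum_(i | ~~ P i) p i * (a i - a0).
pose B := \sum_(i | P i) p i * (b i - b0); pose B' := \sum_(i | ~~ P i) p i * (b i - b0).
have shift (f : J -> R) c : \sum_i p i * f i <= c -> \sum_i p i * (f i - c) <= 0.
  move=> H; under eq_bigr do rewrite mulrBr.
  by rewrite big_split /= sumrN -mulr_suml p1 mul1r subr_le0.
have sp f : \sum_(i | P i) f i + \sum_(i | ~~ P i) f i = \sum_i f i :> R.
  by rewrite [RHS](bigID P).
have AA : A + A' <= 0 by rewrite sp; apply: shift.
have BB : B + B' <= 0 by rewrite sp; apply: shift.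
have B0 : B <= 0.
  by apply: sumr_le0 => i Pi; rewrite mulr_ge0_le0 // subr_le0.
have PQ : \sum_(i | P i) p i + \sum_(i | ~~ P i) p i = 1 by rewrite sp.
have mass0 (S : pred J) (f : J -> R) :
    ~~ (0 < \sum_(i | S i) p i) -> \sum_(i | S i) p i * f i = 0.
  rewrite lt_def sumr_ge0 // andbT negbK psumr_eq0 // => /allP H.
  apply: big1 => i Si; have := H i (mem_index_enum _); rewrite Si => /eqP ->.
  by rewrite mul0r.
(* Both classes carry mass: without the first the mean of [b] would exceed [b0], without the second
   the mean of [a] would exceed [a0]. *)
have [mP|mP] := boolP (0 < \sum_(i | P i) p i); last first.
  have BZ : B = 0 by apply: mass0.
  have mQ : 0 < \sum_(i | ~~ P i) p i.
    have := mP; rewrite -leNgt; lra.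
  have : 0 < B' by apply: wsum_gt0 => // i; rewrite /P -ltNge subr_gt0.
  lra.
have A0 : 0 < A by apply: wsum_gt0 => // i; apply: aP.
have [mQ|mQ] := boolP (0 < \sum_(i | ~~ P i) p i); last first.
  have : A' = 0 by apply: mass0.
  lra.
have pos' j : ~~ P j -> 0 < A * (b j - b0) - (a j - a0) * B.
  move=> Pj; rewrite /A /B mulr_suml mulr_sumr -sumrB.
  under eq_bigr => i _ do rewrite -mulrA [X in _ - X]mulrCA -mulrBr.
  by apply: wsum_gt0 => // i Pi; apply: pos => //; rewrite ltNge.
have : 0 < A * B' - A' * B.
  rewrite /A' /B' mulr_suml mulr_sumr -sumrB.
  under eq_bigr => i _ do rewrite [X in X - _]mulrCA -[X in _ - X]mulrA -mulrBr.
  by apply: wsum_gt0.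
(* From [A' <= - A], [B' <= - B], [0 < A] and [B <= 0] follows [A * B' <= - (A * B) <= A' * B]. *)
nra.
Qed.

(** The law after [s] steps is a finite weighted family of states, and one more step replaces the
    index type [J] by [J * 'I_m]. The one-step bounds hold conditionally on the current state, so
    the drifts add up by linearity of expectation. *)
Lemma random_process (R : realFieldType) (m : nat) (S : Type) (Inv : nat -> S -> Prop)
    (f c : S -> R) al ga x0 :
  Inv 0%N x0 ->
  (forall s x, Inv s x -> exists (P : 'I_m -> R) (y : 'I_m -> S),
     [/\ forall i, 0 <= P i, \sum_i P i = 1, forall i, Inv s.+1 (y i),
         \sum_i P i * f (y i) <= f x + al & \sum_i P i * c (y i) <= c x + ga]) ->
  forall s, exists (J : finType) (p : J -> R) (x : J -> S),
    [/\ forall j, 0 <= p j, \sum_j p j = 1, forall j, Inv s (x j),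
        \sum_j p j * f (x j) <= f x0 + s%:R * al &
        \sum_j p j * c (x j) <= c x0 + s%:R * ga].
Proof.
move=> I0 step; elim=> [|s [J [p [x [p0 p1 xI xf xc]]]]].
  exists unit, (fun=> 1), (fun=> x0).
  by rewrite !big_const card_unit /= !addr0 !mul1r !mul0r !addr0; split=> //; rewrite ler01.
have [P H1] := fin_all_exists (fun j => step _ _ (xI j)).
have [y H] := fin_all_exists H1.
have PJ j : \sum_i P j i = 1 by case: (H j).
have av (h : S -> R) d h0 : (forall j, \sum_i P j i * h (y j i) <= h (x j) + d) ->
    \sum_j p j * h (x j) <= h0 + s%:R * d ->
    \sum_(q : J * 'I_m) p q.1 * P q.1 q.2 * h (y q.1 q.2) <= h0 + s.+1%:R * d.
  move=> Hh hs; rewrite -(pair_bigA _ (fun j i => p j * P j i * h (y j i))) /=.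
  apply: le_trans (_ : \sum_j p j * (h (x j) + d) <= _).
    apply: ler_sum => j _; under eq_bigr do rewrite -mulrA.
    by rewrite -mulr_sumr ler_wpM2l.
  under eq_bigr do rewrite mulrDr.
  by rewrite big_split /= -mulr_suml p1 mul1r -natr1 mulrDl mul1r addrA lerD2r.
exists (J * 'I_m)%type, (fun q => p q.1 * P q.1 q.2), (fun q => y q.1 q.2); split.
- by case=> j i; rewrite mulr_ge0 //; case: (H j).
- rewrite -(pair_bigA _ (fun j i => p j * P j i)) /= -[RHS]p1.
  by apply: eq_bigr => j _; rewrite -mulr_sumr PJ mulr1.
- by case=> j i; case: (H j).
- by apply: av => // j; case: (H j).
- by apply: av => // j; case: (H j).
Qed.
(** * The sparsification process *)

Section Sparsify.
Variables (R : realType) (n k m : nat) (X : 'M[R]_n) (v : 'I_m -> 'cV[R]_n) (cost : 'I_m -> R).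
Variables (Q : 'M[R]_(k, n)) (t : R).

Definition wsum (w : 'I_m -> R) : 'M[R]_n := \sum_i w i *: (v i *m (v i)^T).
Definition bump (w : 'I_m -> R) i om : 'I_m -> R := fun j => w j + om * (j == i)%:R.

Lemma wsum_bump w i om : wsum (bump w i om) = wsum w + om *: (v i *m (v i)^T).
Proof.
rewrite /wsum /bump; under eq_bigr do rewrite scalerDl.
rewrite big_split /=; congr (_ + _); rewrite (bigD1 i) //= eqxx mulr1.
by rewrite big1 ?addr0 // => j /negbTE ->; rewrite mulr0 scale0r.
Qed.

Lemma bf_wsum w x : bf (wsum w) x x = \sum_i w i * dot (v i) x ^+ 2.
Proof. by rewrite bf_sum; apply: eq_bigr => i _; rewrite bfZ bf_outer -expr2. Qed.

Lemma wsum_sym w : (wsum w)^T = wsum w.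
Proof.
by rewrite raddf_sum /=; apply: eq_bigr => i _; rewrite linearZ /= trmx_mul trmxK.
Qed.

Lemma card_supp_bump w i om s : (#|[set j | w j != 0%R]| <= s)%N ->
  (#|[set j | bump w i om j != 0%R]| <= s.+1)%N.
Proof.
move=> ws; apply: leq_trans (_ : #|i |: [set j | w j != 0%R]| <= _)%N.
  apply: subset_leq_card; apply/subsetP => j; rewrite !inE /bump.
  by have [->|ji] := eqVneq j i; rewrite //= mulr0 addr0.
by rewrite cardsU1; case: (_ \notin _) => /=; rewrite ?add1n ?add0n ?ltnS // ltnW.
Qed.

Let Y := \sum_i v i *m (v i)^T.
Let Yb := \sum_i (Q *m v i) *m (Q *m v i)^T.

(** Since [X <= 1], starting at 17 leaves a gap of at least 16, hence a potential of at most
    [\tr Y / 16 <= (16 * t)^-1]. Each step raises the barrier by [16 * t]. *)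
Definition upper_gap s (w : 'I_m -> R) : 'M[R]_n := (17 + 16 * t * s%:R)%:M - X - wsum w.
Definition lower_gap (w : 'I_m -> R) l : 'M[R]_k := Q *m (X + wsum w - l *: Y) *m Q^T.

(** A state pairs the weights with the lower shift. The potential bounds fit a sampling budget of
    [1 / t]: the upper step uses at most [1/16 + 1/16] of it and the lower step [27/32], leaving at
    least [1/32]. *)
Definition barriers s (x : ('I_m -> R) * R) : Prop :=
  [/\ (#|[set i | x.1 i != 0%R]| <= s)%N, forall i, 0 <= x.1 i,
    posdefmx (upper_gap s x.1) /\ \tr (Y *m invmx (upper_gap s x.1)) <= (16 * t)^-1 &
    posdefmx (lower_gap x.1 x.2) /\
      \tr (Yb *m invmx (lower_gap x.1 x.2)) <= 27 / (32 * t)].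

Hypotheses (Xp : posdefmx X) (X1 : forall x, bf X x x <= dot x x).
Hypotheses (Y1 : forall x, bf Y x x <= dot x x) (t0 : 0 < t) (trY : t * \tr Y <= 1).
Hypotheses (QQ : Q *m Q^T = 1%:M) (k0 : (0 < k)%N).

Lemma YbE : Q *m Y *m Q^T = Yb.
Proof.
rewrite /Y mulmx_sumr mulmx_suml; apply: eq_bigr => i _.
by rewrite trmx_mul !mulmxA.
Qed.

Lemma lower_gap_bump w l i om dl :
  lower_gap (bump w i om) (l + dl) =
    lower_gap w l + om *: ((Q *m v i) *m (Q *m v i)^T) - dl *: Yb.
Proof.
rewrite /lower_gap; have -> : X + wsum (bump w i om) - (l + dl) *: Y =
    X + wsum w - l *: Y + om *: (v i *m (v i)^T) - dl *: Y.
  rewrite wsum_bump (scalerDl Y) opprD [in LHS]addrA [in LHS]addrA.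
  by congr (_ - _); rewrite addrAC.
rewrite /lower_gap -YbE trmx_mul mulmxBr mulmxBl mulmxDr mulmxDl -!scalemxAr -!scalemxAl.
by rewrite !mulmxA.
Qed.

Lemma barriers0 : barriers 0 (fun=> 0, - (32 * k%:R * t / 27)).
Proof.
have w0 : wsum (fun=> 0) = 0 by apply: big1 => i _; rewrite scale0r.
split=> //=.
- by rewrite leqn0 cards_eq0; apply/eqP/setP => i; rewrite !inE eqxx.
- set U := upper_gap _ _; have UE : U = 17%:M - X by rewrite /U /upper_gap w0 mulr0 addr0 subr0.
  have Uge x : 16 * dot x x <= bf U x x.
    by rewrite UE bfB bf_scalar; have := X1 x; lra.
  have Up : posdefmx U.
    split=> [|x x0]; first by rewrite /Defs.symmetricmx UE linearB /= tr_scalar_mx (proj1 Xp).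
    by apply: lt_le_trans (Uge x); rewrite mulr_gt0 ?dot_gt0.
  split=> //; rewrite tr_gram.
  apply: le_trans (_ : \sum_i 16^-1 * dot (v i) (v i) <= _).
    apply: ler_sum => i _; rewrite -bf1 -[1%:M in X in _ <= X]invmx1.
    apply: inv_antitone => // [||z]; rewrite ?invr_ge0 //.
      by split=> [|x x0]; rewrite ?/Defs.symmetricmx ?trmx1 // mulmx1 dot_gt0.
    by rewrite bf1 mulrC ler_pdivlMr // mulrC.
  rewrite -mulr_sumr; under eq_bigr do rewrite -bf1.
  rewrite -tr_gram mulmx1 -/Y invfM ler_pM2l ?invr_gt0 //.
  by rewrite -[X in _ <= X]mul1r ler_pdivlMr // mulrC.
- set la := 32 * k%:R * t / 27; have la0 : 0 < la by rewrite /la !mulr_gt0 ?invr_gt0 ?ltr0n //.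
  set D := lower_gap _ _; pose G := Q *m X *m Q^T.
  have DE : D = G + la *: Yb.
    rewrite /D /lower_gap w0 addr0 -YbE scaleNr opprK mulmxDr mulmxDl.
    by rewrite -scalemxAr -scalemxAl.
  have Gp : posdefmx G.
    split=> [|x x0]; first by rewrite /Defs.symmetricmx !trmx_mul trmxK (proj1 Xp) mulmxA.
    rewrite -/(bf _ _ _) /G -{1}(trmxK Q) bf_conj; apply: (proj2 Xp).
    by apply: contra x0 => /eqP H; rewrite -[x]mul1mx -QQ -mulmxA H mulmx0.
  have Dp : posdefmx D.
    split=> [|x x0].
      by rewrite /Defs.symmetricmx DE linearD linearZ /= (proj1 Gp) tr_gram_sym.
    rewrite -/(bf _ _ _) DE bfD bfZ ltr_pwDl ?(proj2 Gp) // mulr_ge0 ?(ltW la0) //.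
    exact: (proj2 (psd_gram _)).
  split=> //; rewrite -(ler_pM2l la0).
  have -> : la * (27 / (32 * t)) = k%:R by rewrite /la; field; rewrite gt_eqF.
  (* As [la *: Yb = D - G], this is the trace of the identity of size [k] minus a nonnegative trace.
     The initial shift is chosen to turn [k / la] into the allowed potential. *)
  have -> : la * \tr (Yb *m invmx D) = k%:R - \tr (G *m invmx D).
    rewrite -linearZ /= scalemxAl -[la *: Yb](addKr G) -DE addrC mulmxBl linearB /=.
    by rewrite mulmxV ?posdef_unit // mxtrace1.
  by rewrite gerBl psd_trace //; apply: posdef_psd => //; apply: posdef_inv.
Qed.

(** Vector [i] has probability [t * a i] and weight [(a i)^-1], with [a i] at least both [U i] and
    [r i], so both barrier steps apply to every outcome. Probability times weight is always [t],
    which makes the mean cost and the mean shift exact. The shift enters negated because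
    [random_process] bounds means from above. *)
Lemma barriers_step s x i0 : v i0 != 0 -> barriers s x ->
  exists (P : 'I_m -> R) (y : 'I_m -> ('I_m -> R) * R),
    [/\ forall i, 0 <= P i, \sum_i P i = 1, forall i, barriers s.+1 (y i),
      \sum_i P i * - (y i).2 <= - x.2 - t / 3 &
      \sum_i P i * (\sum_j (y i).1 j * cost j) <=
        \sum_j x.1 j * cost j + t * \sum_j cost j].
Proof.
case: x => w l vi0 [/= ws w0 [Up trU] [Lp trL]].
have m0 : (0 < m)%N by case: (m) i0 {vi0} => [[]|].
have dl0 : 0 < 16 * t by rewrite mulr_gt0.
have [U [U0 sU stepU]] := upper_step Up Y1 vi0 dl0 trU.
have [r [g [r0 sr sg stepL]]] := lower_step m0 Lp trL.
(* [e] spreads the unused budget, so that the [a i] are positive and sum to [1 / t]. *)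
pose e := (t^-1 - \sum_i U i - \sum_i r i) / m%:R.
have mp : 0 < m%:R :> R by rewrite ltr0n.
have e0 : 0 < e.
  rewrite divr_gt0 //; have : 0 < t^-1 by rewrite invr_gt0.
  have E1 : (16 * t)^-1 = t^-1 / 16 by rewrite invfM mulrC.
  have E2 : 27 / (32 * t) = 27 / 32 * t^-1 by rewrite invfM mulrA.
  move: sU sr; rewrite E1 E2; set ti := t^-1; lra.
pose a i := U i + r i + e.
have a0 i : 0 < a i by rewrite ltr_wpDl // addr_ge0.
have sa : \sum_i a i = t^-1.
  rewrite !big_split /= sumr_const card_ord -[e *+ m]mulr_natr divfK ?gt_eqF //.
  ring.
have taa i : t * a i * (a i)^-1 = t by rewrite mulfK ?gt_eqF.
exists (fun i => t * a i), (fun i => (bump w i (a i)^-1, l + (a i)^-1 * g i / 3)).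
split=> /=.
- by move=> i; rewrite mulr_ge0 ?ltW.
- by rewrite -mulr_sumr sa mulfV ?gt_eqF.
- move=> i; have ai : 0 <= (a i)^-1 by rewrite invr_ge0 ltW.
  split=> /=; first exact: card_supp_bump.
  + by move=> j; rewrite /bump addr_ge0 // mulr_ge0.
  + have UE : upper_gap s.+1 (bump w i (a i)^-1) =
        upper_gap s w + (16 * t)%:M - (a i)^-1 *: (v i *m (v i)^T).
      rewrite /upper_gap wsum_bump -[s.+1%:R]natr1 mulrDr mulr1 addrA raddfD /= opprD addrA.
      by congr (_ - _); rewrite [RHS]addrAC; congr (_ - _); rewrite [RHS]addrAC.
    rewrite UE; apply: stepU => //.
    by rewrite mulrC ler_pdivrMr // mul1r /a -addrA lerDl addr_ge0 // ltW.
  + rewrite lower_gap_bump; apply: stepL => //.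
    by rewrite mulrC ler_pdivrMr // mul1r /a addrAC lerDr addr_ge0 // ltW.
- under eq_bigr => i _ do rewrite mulrN mulrDr !mulrA taa.
  rewrite sumrN big_split /= -!mulr_suml -!mulr_sumr sa sg mulfV ?gt_eqF //; lra.
- rewrite (_ : \sum_i _ = \sum_i (t * a i * (\sum_j w j * cost j) + t * cost i)).
    by rewrite big_split /= -mulr_suml -!mulr_sumr sa mulfV ?gt_eqF // mul1r.
  apply: eq_bigr => i _; rewrite /bump; under eq_bigr do rewrite mulrDl.
  rewrite big_split mulrDr /=; congr (_ + _); rewrite (bigD1 i) //= eqxx mulr1.
  rewrite big1 ?addr0 => [|j /negbTE ->]; last by rewrite mulr0 mul0r.
  by rewrite mulrA taa.
Qed.

(** Two outcomes of the [s]-step process are averaged. Both spectral bounds are affine in the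
    weights and the shift, so they pass to the average, whose support lies in the union of the two
    supports. The factor [s / 3 - 32 k / 27] is the accumulated mean shift plus its negative start,
    divided by [t]. *)
Lemma sparsify s i0 : v i0 != 0 ->
  exists w : 'I_m -> R,
    [/\ (#|[set i | w i != 0%R]| <= 2 * s)%N, forall i, 0 <= w i,
      forall x, bf (X + wsum w) x x <= (17 + 16 * t * s%:R) * dot x x,
      forall z, t * (s%:R / 3 - 32 * k%:R / 27) * bf Y (Q^T *m z) (Q^T *m z) <=
                bf (X + wsum w) (Q^T *m z) (Q^T *m z) &
      \sum_i w i * cost i <= s%:R * (t * \sum_i cost i)].
Proof.
move=> vi0; have [J [p [x [p0 p1 xI xf xc]]]] :=
  random_process barriers0 (fun s x => barriers_step vi0) s.
have [i [j [th [/andP[th0 th1] Hl Hc]]]] := two_point_average p0 p1 xf xc.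
move: Hl Hc (xI i) (xI j) => /=.
case: (x i) (x j) => [w1 l1] [w2 l2] /= Hl Hc [/= s1 w10 [U1 _] [L1 _]] [/= s2 w20 [U2 _] [L2 _]].
have th1' : 0 <= 1 - th by rewrite subr_ge0.
have bw y : bf (wsum (fun i => th * w1 i + (1 - th) * w2 i)) y y =
    th * bf (wsum w1) y y + (1 - th) * bf (wsum w2) y y.
  rewrite !bf_wsum !mulr_sumr -big_split /=; apply: eq_bigr => q _; ring.
have Qb (B : 'M[R]_n) z : bf (Q *m B *m Q^T) z z = bf B (Q^T *m z) (Q^T *m z).
  by rewrite -{1}(trmxK Q) bf_conj.
exists (fun i => th * w1 i + (1 - th) * w2 i); split.
- apply: leq_trans (_ : #|[set i | w1 i != 0%R] :|: [set i | w2 i != 0%R]| <= _)%N.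
    apply: subset_leq_card; apply/subsetP => q; rewrite !inE.
    by apply: contraR; rewrite negb_or !negbK => /andP[/eqP -> /eqP ->]; rewrite !mulr0 addr0.
  by rewrite mul2n -addnn; apply: leq_trans (leq_card_setU _ _) (leq_add _ _).
- by move=> q; rewrite addr_ge0 // mulr_ge0.
- move=> y; rewrite bfD bw.
  have := proj2 (posdef_psd U1) y; have := proj2 (posdef_psd U2) y.
  rewrite /upper_gap !bfB bf_scalar; set K := _ * dot y y => H2 H1.
  have := ler_wpM2l th1' H2; have := ler_wpM2l th0 H1; rewrite !mulr0; nra.
- move=> z; rewrite bfD bw.
  have := proj2 (posdef_psd L1) z; have := proj2 (posdef_psd L2) z.
  rewrite /lower_gap !Qb !bfB !bfD !bfZ.
  have := proj2 (psd_gram v) (Q^T *m z); rewrite -/Y.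
  set by_ := bf Y _ _; set bx := bf X _ _; set b1 := bf (wsum w1) _ _; set b2 := bf (wsum w2) _ _.
  move=> y0 H2 H1; have {}H2 := ler_wpM2l th1' H2; have {}H1 := ler_wpM2l th0 H1.
  have {}Hl : t * (s%:R / 3 - 32 * k%:R / 27) <= th * l1 + (1 - th) * l2.
    by move: Hl; lra.
  have := ler_wpM2r y0 Hl; move: H1 H2; rewrite !mulr0; nra.
- under eq_bigr do rewrite mulrDl -!mulrA.
  rewrite big_split /= -!mulr_sumr; apply: le_trans Hc _.
  by rewrite big1 ?add0r // => q _; rewrite mul0r.
Qed.

End Sparsify.
(** * Eigenvalues as extrema *)

Section Eigenvalues.
Variables (R : realType) (n : nat).
Implicit Types (A : 'M[R]_n) (x : 'cV[R]_n).

Lemma eig_sorted A i j : A^T = A -> (i <= j)%N -> (j < n)%N -> eig A i.+1 <= eig A j.+1.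
Proof.
move=> AT ij jn; have [sz _] := sym_spectral_eig AT.
have srt : sorted <=%R (eigenvalues A) by apply: sort_sorted; apply: le_total.
rewrite /eig /=; apply: (sorted_leq_nth le_trans le_refl _ srt) => //.
  by rewrite inE sz (leq_ltn_trans ij).
by rewrite inE sz.
Qed.

Lemma bf_eig A : A^T = A -> exists Q : 'M[R]_n, [/\ Q *m Q^T = 1%:M,
  forall x, dot x x = \sum_i (Q *m x) i 0 ^+ 2 &
  forall x, bf A x x = \sum_(i < n) eig A i.+1 * (Q *m x) i 0 ^+ 2].
Proof.
move=> AT; have [_ [Q [QQ AE]]] := sym_spectral_eig AT; exists Q; split=> // x.
  rewrite -[x in LHS]mul1mx -(mulmx1C QQ) -mulmxA /dot trmx_mul trmxK.
  rewrite -mulmxA (mulmxA Q) QQ mul1mx mxE; apply: eq_bigr => i _.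
  by rewrite mxE expr2.
rewrite [in LHS]AE bf_conj /bf mxE; apply: eq_bigr => i _.
by rewrite mul_mx_diag !mxE mulrAC mulrC expr2.
Qed.

Lemma eig_attained A i : A^T = A -> (i < n)%N ->
  exists u, dot u u = 1 /\ bf A u u = eig A i.+1.
Proof.
move=> AT lin; have [Q [QQ dE bE]] := bf_eig AT; pose j := Ordinal lin.
have QE : Q *m (Q^T *m delta_mx j 0) = delta_mx j 0 :> 'cV_n.
  by rewrite mulmxA QQ mul1mx.
have E l : (delta_mx j 0 : 'cV[R]_n) l 0 = (l == j)%:R by rewrite mxE andbT.
exists (Q^T *m delta_mx j 0); rewrite dE bE QE; split.
  rewrite (bigD1 j) //= E eqxx expr1n big1 ?addr0 // => l /negbTE lj.
  by rewrite E lj expr0n.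
rewrite (bigD1 j) //= E eqxx expr1n mulr1 big1 ?addr0 // => l /negbTE lj.
by rewrite E lj expr0n mulr0.
Qed.

Lemma lambda_min_le A x : A^T = A -> lambda_min A * dot x x <= bf A x x.
Proof.
move=> AT; have [Q [QQ -> ->]] := bf_eig AT; rewrite mulr_sumr.
by apply: ler_sum => i _; rewrite ler_wpM2r ?sqr_ge0 ?eig_sorted.
Qed.

Lemma lambda_max_ge A x : A^T = A -> bf A x x <= lambda_max A * dot x x.
Proof.
move=> AT; have [Q [QQ -> ->]] := bf_eig AT; rewrite mulr_sumr.
apply: ler_sum => i _; rewrite ler_wpM2r ?sqr_ge0 // /lambda_max.
have n1 : n.-1.+1 = n by rewrite (ltn_predK (ltn_ord i)).
rewrite -[X in _ <= eig A X]n1; apply: eig_sorted; rewrite ?n1 //.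
by rewrite -ltnS n1.
Qed.

Lemma lambda_min_ge A c : A^T = A -> (0 < n)%N ->
  (forall x, c * dot x x <= bf A x x) -> c <= lambda_min A.
Proof.
move=> AT n0 H; have [u [u1 uE]] := eig_attained AT n0.
by rewrite /lambda_min -uE -[c]mulr1 -u1.
Qed.

Lemma lambda_max_le A c : A^T = A -> (0 < n)%N ->
  (forall x, bf A x x <= c * dot x x) -> lambda_max A <= c.
Proof.
move=> AT n0 H; have [|u [u1 uE]] := @eig_attained A n.-1 AT; first by rewrite prednK.
by rewrite prednK // in uE; rewrite /lambda_max -uE -[c]mulr1 -u1.
Qed.

(** The rows of [P] are eigenvectors for the [k] smallest eigenvalues. The difference of squared
    norms measures the component of [x] orthogonal to them, where every eigenvalue is at least
    [eig A k.+1]; the rest of the form is nonnegative and is dropped. *)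
Lemma bottom_space A k : psd A -> (k < n)%N -> exists P : 'M[R]_(k, n),
  P *m P^T = 1%:M /\
  forall x, eig A k.+1 * (dot x x - dot (P *m x) (P *m x)) <= bf A x x.
Proof.
move=> [AT A0] kn; have [Q [QQ dE bE]] := bf_eig AT; have kn' := ltnW kn.
pose P := \matrix_(i < k, j < n) Q (widen_ord kn' i) j; exists P; split.
  apply/matrixP => i j; move/matrixP/(_ (widen_ord kn' i) (widen_ord kn' j)): QQ.
  rewrite !mxE => H; rewrite -[RHS]H; apply: eq_bigr => l _; by rewrite !mxE.
move=> x; have -> : dot (P *m x) (P *m x) = \sum_(i < n | (i < k)%N) (Q *m x) i 0 ^+ 2.
  rewrite (big_ord_narrow kn') /dot mxE; apply: eq_bigr => i _.
  rewrite mxE expr2; congr (_ * _); rewrite !mxE; apply: eq_bigr => l _; by rewrite mxE.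
rewrite dE (bigID (fun i : 'I_n => (i < k)%N)) /= [X in X - _]addrC addrK bE.
rewrite [X in _ <= X](bigID (fun i : 'I_n => (i < k)%N)) /= mulr_sumr.
apply: le_trans (_ : \sum_(i < n | ~~ (i < k)%N) eig A i.+1 * (Q *m x) i 0 ^+ 2 <= _).
  apply: ler_sum => i ki; rewrite ler_wpM2r ?sqr_ge0 // eig_sorted //.
  by rewrite leqNgt.
rewrite lerDr sumr_ge0 // => i _; rewrite mulr_ge0 ?sqr_ge0 //.
by have [u [_ <-]] := eig_attained AT (ltn_ord i).
Qed.

End Eigenvalues.

(** * Combining the two subspaces, and the choice of parameters *)

(** Split [x = a + b] with [a] in the row space of [P] and [b] orthogonal to it. The last hypothesis
    controls [la * |b|^2] by [bf M x x]. On [a], the bound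
    [bf M a a <= 2 * bf M x x + 2 * c * |b|^2] absorbs the cross terms at the price of the factor
    [3 + 2 * c]. *)
Lemma quadratic_lower_bound (R : realType) n k (M : 'M[R]_n) (P : 'M[R]_(k, n)) la ka c :
  psd M -> P *m P^T = 1%:M -> 0 <= la <= 1 -> 0 <= ka <= 1 -> 0 <= c ->
  (forall x, bf M x x <= c * dot x x) ->
  (forall z, ka * dot z z <= bf M (P^T *m z) (P^T *m z)) ->
  (forall x, la * (dot x x - dot (P *m x) (P *m x)) <= bf M x x) ->
  forall x, ka * la * dot x x <= (3 + 2 * c) * bf M x x.
Proof.
move=> [MT M0] PP /andP[la0 la1] /andP[ka0 ka1] c0 Mc Mka Mla x.
set z := P *m x; pose a := P^T *m z; pose b := x - a.
have xa : dot x a = dot z z by rewrite /a /z /dot trmx_mul !mulmxA.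
have aa : dot a a = dot z z.
  by rewrite /a /dot trmx_mul trmxK mulmxA -(mulmxA z^T) PP mulmx1.
have bb : dot b b = dot x x - dot z z.
  rewrite -bf1 /b -scaleN1r !bfDl !bfDr !bfZl !bfZr !bf1 (dotC a) xa aa; ring.
(* The parallelogram law for [a = x - b], with the nonnegative value at [x + b] discarded. *)
have par : bf M a a <= 2 * bf M x x + 2 * bf M b b.
  have := M0 (x + b); rewrite /b -scaleN1r !bfDl !bfDr !bfZl !bfZr.
  rewrite [bf M a x]bfC //; lra.
have := Mla x; have := Mka z; have := Mc b; have := M0 x.
rewrite -/z -bb -/a; have := dot_ge0 b; have -> : dot x x = dot b b + dot z z by rewrite bb subrK.
move: par; set m := bf M x x; set B := dot b b; set Z := dot z z => par B0 m0 H1 H2 H3.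
have H4 : ka * Z <= 2 * m + 2 * (c * B) by lra.
have := ler_wpM2l la0 H4; have := ler_wpM2l ka0 H3; have := ler_wpM2l c0 H3.
have : ka * m <= m by rewrite ler_piMl.
have : la * m <= m by rewrite ler_piMl.
nra.
Qed.
Theorem theorem3p3 :
  forall R : realType,
  exists c1 c2 : R, 0 < c1 /\ 0 < c2 /\
  forall (n k m : nat), (2 <= n)%N -> (1 <= k <= n - 1)%N ->
  forall (X : 'M[R]_n) (v : 'I_m -> 'cV[R]_n) (cost : 'I_m -> R),
    posdefmx X ->
    let Mstar := X + \sum_(i < m) (v i *m (v i)^T) in
    lambda_max Mstar <= 1 ->
    \sum_(i < m) cost i = 1 ->
    let lstar := eig X k.+1 in
    let T : int := Num.ceil (\tr (Mstar - X)) in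
    forall N : nat, (8 * k < N)%N ->
    exists w : 'I_m -> R,
      (#|[set i : 'I_m | w i != 0%R]| <= N)%N /\
      let M := X + \sum_(i < m) w i *: (v i *m (v i)^T) in
      c1 * Num.min (N%:R / T%:~R) 1 * lstar * lambda_min Mstar <= lambda_min M /\
      lambda_min M <= lambda_max M /\
      lambda_max M <= c2 /\
      \sum_(i < m) w i * cost i <= Num.min 1 (N%:R / T%:~R).
Proof.
(* Here [25 = 17 + 16 / 2] since [t * s <= 1 / 2], and [53 = 3 + 2 * 25] comes from
   [quadratic_lower_bound]. Finally [216 = 2 * 4 * 27] collects the losses in [ML], [ts'] and
   [L]. *)
move=> R; exists (53^-1 * 216^-1), 25; rewrite mulr_gt0 ?invr_gt0 //; do 2 split=> //.
move=> n k m n2 /andP[k1 kn] X v cost Xp Mstar Ms1 cost1 lstar T N kN.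
have n0 : (0 < n)%N by apply: leq_trans n2.
have kn' : (k < n)%N by clear -kn n0; lia.
have [XT X0] := posdef_psd Xp.
pose Y := \sum_(i < m) (v i *m (v i)^T).
have [YT Y0] : psd Y := psd_gram v.
have MsT : Mstar^T = Mstar by rewrite /Mstar linearD /= XT YT.
have bMs x : bf Mstar x x = bf X x x + bf Y x x by rewrite bfD.
have Ms1' x : bf Mstar x x <= dot x x.
  apply: le_trans (lambda_max_ge x MsT) _.
  by rewrite -[X in _ <= X]mul1r ler_wpM2r ?dot_ge0.
have X1 x : bf X x x <= dot x x by have := Ms1' x; have := Y0 x; rewrite bMs; lra.
have Y1 x : bf Y x x <= dot x x by have := Ms1' x; have := X0 x; rewrite bMs; lra.
have la01 : 0 <= lstar <= 1.
  by have [u [u1 uE]] := eig_attained XT kn'; rewrite /lstar -uE X0 -u1 X1.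
have mu01 : 0 <= lambda_min Mstar <= 1.
  have [u [u1 uE]] := eig_attained MsT n0.
  by rewrite /lambda_min -uE -u1 Ms1' bMs addr_ge0.
have minmax (M : 'M[R]_n) : M^T = M -> lambda_min M <= lambda_max M.
  move=> MT; rewrite /lambda_max -[n in X in _ <= eig M X](prednK n0).
  by apply: eig_sorted; rewrite // prednK.
have TE : T = Num.ceil (\tr Y) by rewrite /T /Mstar addrC addKr.
(* If all [v i] vanish then [T = 0], and division by zero gives 0, so the minimum is 0 and zero
   weights suffice. *)
have [/existsP[i0 vi0]|/existsPn v0] := boolP [exists i, v i != 0]; last first.
  have v0' i : v i = 0 by have := v0 i; rewrite negbK => /eqP.
  have YZ : Y = 0 by apply: big1 => i _; rewrite v0' mul0mx.
  have T0 : T = 0 by rewrite TE YZ mxtrace0 ceil0.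
  exists (fun=> 0); split.
    by apply: leq_trans (leq0n _); rewrite leqn0 cards_eq0; apply/eqP/setP => i; rewrite !inE eqxx.
  rewrite big1 => [|i _]; last by rewrite scale0r.
  rewrite addr0 /= T0 invr0 mulr0.
  split; last split; first last.
  - split; last by rewrite big1 ?le_min ?lexx ?ler01 // => i _; rewrite mul0r.
    by apply: lambda_max_le => // x; have := X1 x; have := dot_ge0 x; lra.
  - exact: minmax.
  - rewrite (min_idPl _) ?ler01 // mulr0 !mul0r.
    by apply: lambda_min_ge => // x; rewrite mul0r.
have trY0 : 0 < \tr Y.
  have := tr_gram v 1%:M; rewrite mulmx1 => ->.
  under eq_bigr do rewrite bf1.
  by rewrite (bigD1 i0) //= ltr_pwDl ?dot_gt0 // sumr_ge0 // => i _; rewrite dot_ge0.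
have TY : \tr Y <= T%:~R by rewrite TE ceil_ge.
have T0 : 0 < T%:~R :> R by apply: lt_le_trans TY.
have N0 : 0 < N%:R :> R by rewrite ltr0n; apply: leq_ltn_trans kN.
(* With this [t], [N] steps would have mean cost [tau], and [tau <= N / T] gives
   [t * \tr Y <= 1]. *)
pose tau := Num.min (N%:R / T%:~R) 1 : R; pose t := tau / N%:R.
have tau0 : 0 < tau by rewrite lt_min divr_gt0 //= ltr01.
have tau1 : tau <= 1 by rewrite ge_min lexx orbT.
have tauN : tau <= N%:R / T%:~R by rewrite ge_min lexx.
have t0 : 0 < t by rewrite divr_gt0.
have trY : t * \tr Y <= 1.
  apply: le_trans (_ : t * T%:~R <= _); first by rewrite ler_wpM2l // ltW.
  rewrite /t mulrAC ler_pdivrMr // mul1r.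
  by rewrite ler_pdivlMr in tauN.
have [P [PP Pb]] := bottom_space (conj XT X0) kn'.
(* Half of [N], because averaging two outcomes doubles the support. *)
pose s := N./2.
have sN2 : (2 * s <= N)%N by rewrite mul2n -[X in (_ <= X)%N](odd_double_half N) leq_addl.
have ks : (4 * k <= s)%N by rewrite /s; clear -kN; lia.
have Ns : (N <= 4 * s)%N by rewrite /s; clear -kN k1; lia.
have [w [ws w0 wU wL wc]] := sparsify cost Xp X1 Y1 t0 trY PP k1 s vi0.
exists w; split; first exact: leq_trans ws sN2.
rewrite /= -/(wsum v w); set M := X + wsum v w.
have MT : M^T = M by rewrite linearD /= XT wsum_sym.
have bM x : bf X x x <= bf M x x.
  by rewrite bfD lerDl bf_wsum sumr_ge0 // => i _; rewrite mulr_ge0 ?sqr_ge0.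
have ts : t * s%:R <= tau / 2.
  rewrite /t mulrAC ler_pdivrMr // -mulrA ler_pM2l //.
  by rewrite mulrC ler_pdivlMr // mulrC -natrM ler_nat.
have ts' : tau / 4 <= t * s%:R.
  rewrite /t mulrAC ler_pdivlMr // -mulrA ler_pM2l //.
  by rewrite mulrC ler_pdivrMr // mulrC -natrM ler_nat.
have MU x : bf M x x <= 25 * dot x x.
  apply: le_trans (wU x) _; rewrite ler_wpM2r ?dot_ge0 // -mulrA; lra.
pose L := t * s%:R / 27.
have L0 : 0 <= L by rewrite /L !mulr_ge0 ?invr_ge0 ?ler0n // ltW.
have L1 : L <= 1 by rewrite /L; lra.
(* This is where [8 * k < N] enters: [4 * k <= s] gives [32 k / 27 <= 8 s / 27], leaving [s / 27]
   out of [9 s / 27]. *)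
have LL : L <= t * (s%:R / 3 - 32 * k%:R / 27).
  rewrite /L -mulrA ler_pM2l //; have : (4 * k)%:R <= s%:R :> R by rewrite ler_nat.
  rewrite natrM; lra.
have [mu0 mu1] := andP mu01.
(* On this subspace [M] dominates both [X] and [L *: Y], hence, as [L <= 1], half of
   [L *: Mstar]. *)
have ML z : L * lambda_min Mstar / 2 * dot z z <= bf M (P^T *m z) (P^T *m z).
  set a := P^T *m z; have az : dot a a = dot z z.
    by rewrite /a /dot trmx_mul trmxK mulmxA -(mulmxA z^T) PP mulmx1.
  have H1 := wL z; rewrite -/a -/M -/Y in H1.
  have H2 := bM a; have H3 := lambda_min_le a MsT; rewrite az bMs in H3.
  have H4 := ler_wpM2r (Y0 a) LL; have H5 := ler_wpM2l L0 H3.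
  have H6 : L * bf X a a <= bf X a a by rewrite ler_piMl.
  lra.
have ka01 : 0 <= L * lambda_min Mstar / 2 <= 1.
  have := mulr_ge0 L0 mu0; have : L * lambda_min Mstar <= 1 by rewrite mulr_ile1.
  by move=> *; apply/andP; split; lra.
have Mpsd : psd M by split=> // x; apply: le_trans (X0 x) (bM x).
have Pb' x : lstar * (dot x x - dot (P *m x) (P *m x)) <= bf M x x.
  exact: le_trans (Pb x) (bM x).
have fin := quadratic_lower_bound Mpsd PP la01 ka01 (ler0n R 25) MU ML Pb'.
have [la0 la1] := andP la01.
split; last split; first last.
- split; first exact: lambda_max_le.
  apply: le_trans wc _; rewrite cost1 mulr1 minC -/tau mulrC.
  by apply: le_trans ts _; lra.
- exact: minmax.
apply: lambda_min_ge => // x; rewrite -/tau.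
have H : L * lambda_min Mstar / 2 * lstar * dot x x <= 53 * bf M x x.
  by apply: le_trans (fin x) _; rewrite ler_wpM2r ?(proj2 Mpsd) //; lra.
have e0 : 0 <= lstar * lambda_min Mstar * dot x x by rewrite !mulr_ge0 ?dot_ge0.
have tL : tau / 108 <= L by rewrite /L; lra.
have := ler_wpM2r e0 tL; lra.
Qed.
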